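(* Let $V_1,\dots,V_d$ be real Banach spaces, $\mathbf V={}_a\bigotimes_{j=1}^d V_j$ their algebraic tensor product, $\|\cdot\|$ a norm on $\mathbf V$, and let $\mathbf V_{\|\cdot\|}$ be the completion of $\mathbf V$ with respect to $\|\cdot\|$, assumed reflexive. Let $\mathcal S_1$ be a weakly closed subset of $\mathbf V_{\|\cdot\|}$ satisfying (B1)–(B3) below. Let $J:\mathbf V_{\|\cdot\|}\to\mathbb R$ satisfy (A1) and (A2) below, and assume in addition that $J$ is weakly sequentially continuous on $\mathbf V_{\|\cdot\|}$, i.e. $\mathbf v_n\rightharpoonup \mathbf v$ in $\mathbf V_{\|\cdot\|}$ implies $J(\mathbf v_n)\to J(\mathbf v)$. Then every progressive Proper Generalized Decomposition $\{\mathbf u_m\}_{m\ge1}$, over $\mathcal S_1$, of $\mathbf u=\arg\min_{\mathbf v\in \mathbf V_{\|\cdot\|}}J(\mathbf v)$ converges in $\mathbf V_{\|\cdot\|}$ to $\mathbf u$, that is, $\lim_{m\to\infty}\|\mathbf u-\mathbf u_m\|=0$.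
   Context: A subset $M$ of a Banach space is called weakly closed if $v_n\in M$ and $v_n\rightharpoonup v$ (weak convergence of sequences) imply $v\in M$. $\langle\cdot,\cdot\rangle$ is the duality pairing between the dual $\mathbf V_{\|\cdot\|}^*$ and $\mathbf V_{\|\cdot\|}$. Assumptions on $\mathcal S_1$: (B1) $\mathcal S_1\subset\mathbf V$ and $\mathbf 0\in\mathcal S_1$; (B2) $\lambda\mathbf v\in\mathcal S_1$ for all $\mathbf v\in\mathcal S_1$, $\lambda\in\mathbb R$; (B3) $\mathrm{span}\,\mathcal S_1$ is dense in $\mathbf V_{\|\cdot\|}$. Assumptions on $J$: (A1) $J$ is Fréchet differentiable, with Fréchet differential $J':\mathbf V_{\|\cdot\|}\to\mathbf V_{\|\cdot\|}^*$; (A2) $J$ is elliptic: there exist $\alpha>0$ and $s>1$ (the ellipticity exponent) such that $\langle J'(\mathbf v)-J'(\mathbf w),\mathbf v-\mathbf w\rangle\ge\alpha\|\mathbf v-\mathbf w\|^s$ for all $\mathbf v,\mathbf w\in\mathbf V_{\|\cdot\|}$. Under (A1)–(A2), $J$ has a unique minimizer $\mathbf u$ on $\mathbf V_{\|\cdot\|}$. Progressive Proper Generalized Decomposition (PGD) of $\mathbf u$ over $\mathcal S_1$: a sequence $\{\mathbf u_m\}_{m\ge1}$ constructed as follows. Set $\mathbf u_0=\mathbf 0$. For each $m\ge1$, choose $\hat{\mathbf z}_m\in\mathcal S_1$ with $J(\mathbf u_{m-1}+\hat{\mathbf z}_m)=\min_{\mathbf z\in\mathcal S_1}J(\mathbf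 u_{m-1}+\mathbf z)$, and then apply one of three strategies, recorded by a symbol $\boldsymbol\alpha_m\in\{c,l,r\}$: - $\boldsymbol\alpha_m=c$: $\mathbf z_m=\hat{\mathbf z}_m$ and $\mathbf u_m=\mathbf u_{m-1}+\mathbf z_m$. - $\boldsymbol\alpha_m=l$: $\mathbf z_m=\hat{\mathbf z}_m$; choose a closed linear subspace $\mathbf U$ of $\mathbf V_{\|\cdot\|}$ with $\mathbf u_{m-1}+\mathbf z_m\in\mathbf U$, and set $\mathbf u_m=\arg\min_{\mathbf v\in\mathbf U}J(\mathbf v)$. - $\boldsymbol\alpha_m=r$: choose a closed linear subspace $\mathbf U$ of $\mathbf V_{\|\cdot\|}$ with $\hat{\mathbf z}_m\in\mathbf U$, set $\mathbf z_m=\arg\min_{\mathbf z\in\mathbf U}J(\mathbf u_{m-1}+\mathbf z)$ and $\mathbf u_m=\mathbf u_{m-1}+\mathbf z_m$. The strategy and the subspaces may be chosen differently (arbitrarily) at each step. *)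

(* Defs.v *)
(* MathComp-Analysis *)
From HB Require Import structures.
From mathcomp Require Import all_boot all_order all_algebra.
From mathcomp Require Import all_classical all_reals all_analysis.
Import Order.TTheory GRing.Theory Num.Theory.
Import numFieldNormedType.Exports.

Set Implicit Arguments.
Unset Strict Implicit.
Unset Printing Implicit Defensive.

Local Open Scope classical_set_scope.
Local Open Scope ring_scope.

Definition multilinear (R : realType) (d : nat) (V_ : 'I_d -> lmodType R)
    (E : lmodType R) (phi : (forall j, V_ j) -> E) : Prop :=
  forall (v : forall j, V_ j) (j : 'I_d) (a : R) (x y : V_ j),
    phi (dfwith v j (a *: x + y)) =
    a *: phi (dfwith v j x) + phi (dfwith v j y).

(* [V], with [tensor v] playing the role of v_1 (x) ... (x) v_d, is the
   algebraic tensor product of the [V_ j]: the universal property, which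
   determines [V] and [tensor] up to a unique linear isomorphism. *)
Definition algebraic_tensor_product (R : realType) (d : nat)
    (V_ : 'I_d -> lmodType R) (V : lmodType R)
    (tensor : (forall j, V_ j) -> V) : Prop :=
  multilinear tensor /\
  forall (E : lmodType R) (phi : (forall j, V_ j) -> E), multilinear phi ->
    exists! L : V -> E, linear L /\ forall v, L (tensor v) = phi v.

(* A completion of [V] is a Banach space [W] together with an isometric linear
   embedding of [V] with dense range. *)
Definition completion (R : realType) (V : normedModType R)
    (W : completeNormedModType R) (iota : V -> W) : Prop :=
  [/\ linear iota, forall v, `|iota v| = `|v| & dense (range iota)].

Section NormedSpace.
Context {R : realType} {W : normedModType R}.

Definition dual_space : set (W -> R^o) := [set f | linear f /\ continuous f].

Definition dual_norm (f : W -> R^o) : R :=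
  sup [set `|f x| | x in [set x : W | `|x| <= 1]].

(* Elements of the bidual are represented by functionals on all of [W -> R^o],
   of which only the values on [dual_space] matter. *)
Definition bidual_space : set ((W -> R^o) -> R^o) :=
  [set Phi |
    (forall (a : R) (f g : W -> R^o), dual_space f -> dual_space g ->
       Phi (a *: f + g) = a *: Phi f + Phi g) /\
    (exists C : R, forall f, dual_space f -> `|Phi f| <= C * dual_norm f)].

Definition weak_cvg (v_ : nat -> W) (v : W) : Prop :=
  forall f, dual_space f -> f (v_ n) @[n --> \oo] --> f v.

Definition weakly_closed (M : set W) : Prop :=
  forall (v_ : nat -> W) (v : W), (forall n, M (v_ n)) -> weak_cvg v_ v -> M v.

Definition weakly_seq_continuous (J : W -> R^o) : Prop :=
  forall (v_ : nat -> W) (v : W), weak_cvg v_ v ->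
    J (v_ n) @[n --> \oo] --> J v.

Definition linear_subspace (U : set W) : Prop := submod_closed (mem U).

Definition linear_span (A : set W) : set W := smallest linear_subspace A.

(* The pairing <J'(v), h> is ['d J v h]. *)
Definition elliptic (J : W -> R^o) : Prop :=
  exists alpha s : R, [/\ 0 < alpha, 1 < s &
    forall v w : W,
      alpha * `|v - w| `^ s <= 'd J v (v - w) - 'd J w (v - w)].

Definition is_argmin (A : set W) (F : W -> R^o) (x : W) : Prop :=
  A x /\ forall y, A y -> F x <= F y.

Definition closed_subspace (U : set W) : Prop := linear_subspace U /\ closed U.

Inductive strategy := strategy_c | strategy_l | strategy_r.

Definition pgd_step (S1 : set W) (J : W -> R^o) (a : strategy)
    (uprev zhat z unext : W) : Prop :=
  is_argmin S1 (fun y => J (uprev + y)) zhat /\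
  match a with
  | strategy_c => z = zhat /\ unext = uprev + z
  | strategy_l => z = zhat /\
      exists U : set W,
        [/\ closed_subspace U, U (uprev + z) & is_argmin U J unext]
  | strategy_r =>
      (exists U : set W, [/\ closed_subspace U, U zhat &
        is_argmin U (fun y => J (uprev + y)) z]) /\
      unext = uprev + z
  end.

(* The entries of index 0 of [alpha_], [zhat_] and [z_] are irrelevant. *)
Definition progressive_pgd (S1 : set W) (J : W -> R^o) (u_ : nat -> W) : Prop :=
  u_ 0%N = 0 /\
  exists (alpha_ : nat -> strategy) (zhat_ z_ : nat -> W), forall m : nat,
    pgd_step S1 J (alpha_ m.+1) (u_ m) (zhat_ m.+1) (z_ m.+1) (u_ m.+1).

End NormedSpace.

Arguments dual_space {R} W.
Arguments bidual_space {R} W.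

Definition reflexive_space (R : realType) (W : normedModType R) : Prop :=
  forall Phi, bidual_space W Phi -> exists x : W, forall f, dual_space W f -> Phi f = f x.

(* Main.v *)
Require Import Defs.
From HB Require Import structures.
From mathcomp Require Import all_boot all_order all_algebra.
From mathcomp Require Import all_classical all_reals all_analysis.
From mathcomp Require Import lra.
Import Order.TTheory GRing.Theory Num.Theory.
Import numFieldNormedType.Exports.

Local Open Scope classical_set_scope.
Local Open Scope ring_scope.

(** Whatever strategy is chosen at a step, the value [J (u_ m.+1)] is at most
    [J (u_ m + z)] for every [z] in [S1] ([pgd_step_le]).  Since [0] is in
    [S1], the values [J (u_ m)] decrease to some limit [L], and since [J] is
    coercive ([sublevel_bounded]) the iterates are bounded.  By reflexivity a
    subsequence converges weakly to some [w]
    ([weakly_convergent_subsequence]); as [J] is weakly sequentially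
    continuous, [J w = L], and passing to the limit in the inequality above
    gives [J w <= J (w + z)] for [z] in [S1].  The set [S1] is a cone, so the
    differential of [J] at [w] vanishes on [S1], hence on its dense span, and
    by convexity [w] minimizes [J] ([argmin_cone]).  Thus [J (u_ m)] tends to
    the minimum of [J], and uniform convexity turns this into norm convergence
    to the minimizer.

    Ellipticity is used only through uniform convexity: [J] lies above each of
    its tangent hyperplanes by a fixed amount outside each ball around the
    point of contact ([elliptic_uniformly_convex]).

    The main ingredient is that bounded sequences have weakly convergent
    subsequences.  In a general reflexive space this rests on the Hahn-Banach
    theorem; here [J] itself supplies the functionals.
    - Along an ultrafilter a bounded sequence has a weak limit: the limits of
      the values of the functionals define an element of the bidual
      ([ultrafilter_weak_limit]).
    - Such a limit stays in every closed midpoint-convex set [Y] that contains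
      the sequence ([weak_limit_mem]).  Instead of separating a point from
      [Y], one translates [Y] so that the limit becomes the minimizer of [J],
      and minimizes [J] over the translate: the differential of [J] at that
      minimizer is the separating functional.
    - The differentials of [J] at the points of a set separate the points of
      its closure ([separating_eq]).  This is where a norming family would
      otherwise be needed.
    - The midpoint-convex hull of the sequence is countable, so a subsequence
      can be made to converge against the differentials at all points of this
      hull.  Any two ultrafilter limits of that subsequence lie in the closed
      hull and agree on these functionals, so they coincide; therefore the
      subsequence converges weakly. *)

Set Implicit Arguments.
Unset Strict Implicit.

(** * Preliminaries on limits *)

Lemma cvg_ge (R : realType) (T : Type) (F : set_system T) (f : T -> R)
    (l a : R) : ProperFilter F -> f x @[x --> F] --> l ->
  (\forall x \near F, a <= f x) -> a <= l.
Proof.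
move=> FF fl af; rewrite -(cvg_lim (@Rhausdorff R) fl); apply: limr_ge => //.
by apply/cvg_ex; exists l.
Qed.

Lemma cvg_le (R : realType) (T : Type) (F : set_system T) (f : T -> R)
    (l b : R) : ProperFilter F -> f x @[x --> F] --> l ->
  (\forall x \near F, f x <= b) -> l <= b.
Proof.
move=> FF fl fb; rewrite -(cvg_lim (@Rhausdorff R) fl); apply: limr_le => //.
by apply/cvg_ex; exists l.
Qed.

Lemma ultrafilter_bounded_cvg (R : realType) (T : Type) (F : set_system T)
    (g : T -> R) (M : R) :
  UltraFilter F -> (forall t, `|g t| <= M) -> cvg (g t @[t --> F]).
Proof.
move=> FU gM.
have GU : UltraFilter (g t @[t --> F]).
  split; first exact: fmap_proper_filter.
  move=> G GF sFG; rewrite predeqE => A; split; last exact: sFG.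
  move=> GA; have [//|FnA] := in_ultra_setVsetC (g @^-1` A) FU.
  have GnA : G (~` A) by apply: sFG.
  by have := filter_ex (filterI GA GnA); case=> z [].
have := @segment_compact R (- M) M; rewrite compact_ultra /=.
move=> /(_ (g t @[t --> F]) GU)[|p [_ gp]].
  by apply: nearW => t /=; rewrite in_itv /= -ler_norml.
by apply/cvg_ex; exists p.
Qed.

(** * Continuous linear functionals and ultrafilter limits *)

Section Dual.
Context {R : realType} {W : normedModType R}.

Lemma dual0 (f : W -> R^o) : dual_space W f -> f 0 = 0.
Proof.
by case=> fl _; have := fl (-1) 0 0; rewrite scaler0 addr0 scaleN1r addNr.
Qed.

Lemma dualZ (f : W -> R^o) (a : R) (x : W) : dual_space W f ->
  f (a *: x) = a * f x.
Proof.
by move=> fd; have [fl _] := fd; rewrite -[a *: x]addr0 fl dual0 // addr0.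
Qed.

Lemma dualB (f : W -> R^o) (x y : W) : dual_space W f ->
  f (x - y) = f x - f y.
Proof.
by move=> [fl _]; rewrite [x - y]addrC -scaleN1r fl scaleN1r addrC.
Qed.

Lemma dual_norm_ub (f : W -> R^o) (x : W) :
  dual_space W f -> `|x| <= 1 -> `|f x| <= dual_norm f.
Proof.
case=> fl fc x1; apply: ub_le_sup; last by exists x.
pose f' : {linear W -> R^o} := HB.pack f (GRing.isLinear.Build _ _ _ _ _ fl).
have /linear_bounded_continuous/linear_boundedP := (fc : continuous f').
move=> /pinfty_ex_gt0[r r0 fr].
exists r => _ [z z1 <-]; apply: le_trans (fr z) _.
by rewrite -[leRHS]mulr1 ler_pM2l.
Qed.

Lemma dual_norm_ge0 (f : W -> R^o) : dual_space W f -> 0 <= dual_norm f.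
Proof.
by move=> fd; apply: le_trans (dual_norm_ub fd (x := 0) _); rewrite // normr0.
Qed.

Lemma dual_norm_ge (f : W -> R^o) (x : W) :
  dual_space W f -> `|f x| <= dual_norm f * `|x|.
Proof.
move=> fd; have [x0|x0] := eqVneq x 0.
  by rewrite x0 dual0 // !normr0 mulr0.
have nx : 0 < `|x| by rewrite normr_gt0.
have {1}-> : x = `|x| *: (`|x|^-1 *: x).
  by rewrite scalerA divff ?scale1r ?gt_eqF.
rewrite dualZ // normrM normr_id mulrC ler_pM2r // dual_norm_ub //.
by rewrite normrZ ger0_norm ?invr_ge0// mulVf ?gt_eqF.
Qed.

(** Along an ultrafilter all the bounded families [f (u t)] converge; their
    limits are linear in [f] and bounded by [M * dual_norm f], so reflexivity
    represents them by a point of the space. *)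
Lemma ultrafilter_weak_limit (T : Type) (F : set_system T) (u : T -> W)
    (M : R) :
  reflexive_space W -> UltraFilter F -> (forall t, `|u t| <= M) ->
  exists x, forall f, dual_space W f -> f (u t) @[t --> F] --> f x.
Proof.
move=> refl FU uM.
have bf f t : dual_space W f -> `|f (u t)| <= M * dual_norm f.
  move=> fd; apply: le_trans (dual_norm_ge _ fd) _; rewrite mulrC.
  by apply: ler_wpM2r (uM t); exact: dual_norm_ge0.
have cf f : dual_space W f -> cvg (f (u t) @[t --> F]).
  by move=> fd; apply: ultrafilter_bounded_cvg => t; exact: bf.
pose Phi (f : W -> R^o) : R^o := lim (f (u t) @[t --> F]).
have [|x hx] := refl Phi.
  split.
    move=> a f g fd gd; apply: (@cvg_lim R^o) => //.
    by apply: cvgD; [apply: cvgZr; exact: cf|exact: cf].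
  exists M => f fd; apply: (cvg_le _ (cvg_norm (cf f fd))).
  by apply: nearW => t; exact: bf.
by exists x => f fd; rewrite -hx //; exact: cf.
Qed.

End Dual.

Lemma weak_cvg_addr (R : realType) (W : normedModType R) (v_ : nat -> W)
    (v z : W) : weak_cvg v_ v -> weak_cvg (fun n => v_ n + z) (v + z).
Proof.
move=> vv f fd.
have -> : (fun n => f (v_ n + z)) = (fun n => f (v_ n) - f (- z)).
  by apply/funext => n; rewrite -(dualB _ _ fd) opprK.
rewrite -[in X in _ --> X](opprK z) (dualB _ _ fd).
by apply: cvgB; [exact: vv|exact: cvg_cst].
Qed.

(** * Midpoint-convex sets *)

Lemma scale_half_double (R : realType) (W : lmodType R) (x : W) :
  (2^-1 : R) *: (x + x) = x.
Proof.
by rewrite -mulr2n -[x *+ 2]scaler_nat scalerA mulVf ?scale1r ?pnatr_eq0.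
Qed.

Definition midpoint_closed (R : realType) (W : lmodType R) (Y : set W)
    : Prop :=
  forall v w, Y v -> Y w -> Y ((2^-1 : R) *: (v + w)).

Lemma closureP_norm (R : realType) (W : normedModType R) (A : set W) (p : W) :
  closure A p <-> forall e : R, 0 < e -> exists2 a, A a & `|p - a| < e.
Proof.
split=> [cA e e0|h B /nbhs_normP[e /= e0 eB]].
  have [a [Aa]] := cA _ (nbhsx_ballx p e e0).
  by rewrite -ball_normE /= => pa; exists a.
by have [a Aa pa] := h e e0; exists a; split => //; exact: eB.
Qed.

Lemma midpoint_closed_closure (R : realType) (W : normedModType R) (Y : set W) :
  midpoint_closed Y -> midpoint_closed (closure Y).
Proof.
move=> mY v w /closureP_norm Yv /closureP_norm Yw; apply/closureP_norm => e e0.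
have [a Ya va] := Yv e e0; have [b Yb wb] := Yw e e0.
exists ((2^-1 : R) *: (a + b)); first exact: mY.
rewrite -scalerBr normrZ ger0_norm ?invr_ge0//.
have -> : v + w - (a + b) = (v - a) + (w - b) by rewrite opprD addrACA.
have := ler_normD (v - a) (w - b); lra.
Qed.

(** The iterated midpoints of a sequence, indexed by binary trees so that the
    midpoint-convex hull comes with an enumeration: [GenTree.tree nat] is a
    countable type.  Nodes that are not binary get a junk value from the
    sequence. *)
Fixpoint midpoint_tree (R : realType) (W : lmodType R) (u : nat -> W)
    (t : GenTree.tree nat) : W :=
  match t with
  | GenTree.Leaf n => u n
  | GenTree.Node _ [:: a; b] =>
      (2^-1 : R) *: (midpoint_tree u a + midpoint_tree u b)
  | GenTree.Node _ _ => u 0%N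
  end.

Lemma midpoint_closed_tree (R : realType) (W : lmodType R) (u : nat -> W) :
  midpoint_closed (range (midpoint_tree u)).
Proof.
by move=> _ _ [a _ <-] [b _ <-]; exists (GenTree.Node 0 [:: a; b]).
Qed.

(** * Differentiable functionals *)

Section Differential.
Context {R : realType} {W : normedModType R} (J : W -> R^o)
  (dJ : forall v : W, differentiable J v).

Lemma mean_value (w h : W) :
  exists2 t : R, 0 < t < 1 & J (w + h) - J w = 'd J (w + t *: h) h.
Proof.
pose f (t : R) : R^o := J (w + t *: h).
have fd (t : R) : is_diff t f (fun x => 'd J (w + t *: h) (x *: h)).
  apply: is_diff_comp.
    have -> : (fun x : R => w + x *: h) = cst w + ( *:%R ^~ h) by [].
    by apply: is_diff_eq; rewrite add0r.
  exact: differentiableP.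
have fD (t : R) : is_derive t (1 : R) f ('d J (w + t *: h) h).
  split.
    by apply: diff_derivable; have [] := fd t.
  have [ft et] := fd t; rewrite deriveE //.
  transitivity ('d J (w + t *: h) ((1 : R) *: h)); last by rewrite scale1r.
  exact: (congr1 (fun g => g 1) et).
have [|t /itvP t01] := @MVT R f (fun t => 'd J (w + t *: h) h) 0 1 ltr01
  (fun t _ => fD t).
  apply: continuous_subspaceT => t; apply: differentiable_continuous.
  by have [] := fd t.
rewrite /f scale1r scale0r addr0 subr0 mulr1 => e; exists t => //.
by rewrite !t01.
Qed.

Lemma diffZ (v h : W) (t : R) : 'd J v (t *: h) = t * 'd J v h.
Proof. exact: linearZ. Qed.

Lemma dual_diff (v : W) : dual_space W ('d J v).
Proof. split; [exact: linearP | exact: diff_continuous]. Qed.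

(** The difference quotients along dyadic steps suffice to sign the directional
    derivative; in a midpoint-convex set only these steps are available. *)
Lemma diff_ge0 (y h : W) :
  (forall k, J y <= J (y + (2^-1 : R) ^+ k *: h)) -> 0 <= 'd J y h.
Proof.
move=> hk.
have Dh : derivable J y h by exact: diff_derivable.
rewrite -deriveE //.
have c : (2^-1 : R) ^+ k @[k --> \oo] --> (0:R)^'.
  have c0 : (2^-1 : R) ^+ k @[k --> \oo] --> (0:R).
    by apply: cvg_expr; rewrite ger0_norm; lra.
  move=> A /c0; rewrite /= !near_simpl; apply: (@filterS _ \oo) => k; apply.
  by rewrite expf_neq0.
have cc := cvg_comp _ _ c Dh.
apply: (cvg_ge _ cc); apply: nearW => k /=.
rewrite -[_ *: _]/(_ * _) mulr_ge0 // ?invr_ge0 ?exprn_ge0//.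
by rewrite subr_ge0 addrC.
Qed.

(** Repeated halving moves from [v] towards [y] without leaving [Y]. *)
Lemma diff_argmin_ge0 (Y : set W) (y v : W) : midpoint_closed Y ->
  is_argmin Y J y -> Y v -> 0 <= 'd J y (v - y).
Proof.
move=> mY [Yy ymin] Yv; apply: diff_ge0 => // k; apply: ymin.
elim: k => [|k IHk]; first by rewrite expr0 scale1r subrKC.
suff <- : (2^-1 : R) *: (y + (y + (2^-1 : R) ^+ k *: (v - y))) =
  y + (2^-1 : R) ^+ k.+1 *: (v - y) by exact: mY.
by rewrite addrA scalerDr scalerA -exprS scale_half_double.
Qed.

End Differential.

(** * Uniform convexity *)

(** The gap [kappa] above the tangent hyperplane is uniform in the point of
    contact [w]. *)
Definition uniformly_convex (R : realType) (W : normedModType R)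
    (J : W -> R^o) : Prop :=
  forall eps : R, 0 < eps -> exists2 kappa : R, 0 < kappa &
    forall v w : W, eps <= `|v - w| -> J w + 'd J w (v - w) + kappa <= J v.

(** The mean value theorem and monotonicity of the differential give convexity
    [J w + 'd J w h <= J (w + h)].  Convexity on each half of the segment from
    [w] to [v], together with ellipticity between [w] and the midpoint, then
    yields the strict gap without integrating the power. *)
Lemma elliptic_uniformly_convex (R : realType) (W : normedModType R)
    (J : W -> R^o) :
  (forall v : W, differentiable J v) -> elliptic J -> uniformly_convex J.
Proof.
move=> dJ [alpha [s [a0 s1 ell]]].
have cvx (w h : W) : J w + 'd J w h <= J (w + h).
  have [t /andP[t0 t1] e] := mean_value dJ w h.
  have := ell (w + t *: h) w.
  rewrite addrAC subrr add0r !diffZ -mulrBr => /(le_trans _) le.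
  have : 0 <= t * ('d J (w + t *: h) h - 'd J w h).
    by apply: le; rewrite mulr_ge0 ?powR_ge0// ltW.
  by rewrite pmulr_rge0 // subr_ge0 -e; lra.
move=> eps e0; exists (alpha * (eps / 2) `^ s).
  by rewrite mulr_gt0 // powR_gt0 // divr_gt0.
move=> v w vw.
pose h := (2^-1 : R) *: (v - w).
have hh : h + h = v - w by rewrite -scalerDr scale_half_double.
have c1 := cvx w h; have c2 := cvx (w + h) h.
have -> : v = w + h + h by rewrite -addrA hh subrKC.
have -> : w + h + h - w = h + h by rewrite -(addrA w) [w + _]addrC addrK.
have := ell (w + h) w; rewrite addrAC subrr add0r linearD => c3.
have : alpha * (eps / 2) `^ s <= alpha * `|h| `^ s.
  rewrite ler_pM2l // ge0_ler_powR ?nnegrE//; [lra|lra|].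
  by rewrite /h normrZ ger0_norm ?invr_ge0// mulrC; nra.
rewrite /= in c1 c2 c3 *; lra.
Qed.

Section UniformlyConvex.
Context {R : realType} {W : normedModType R} (J : W -> R^o)
  (dJ : forall v : W, differentiable J v) (ucJ : uniformly_convex J).

Lemma uniformly_convex_convex (v w : W) : J w + 'd J w (v - w) <= J v.
Proof.
have [->|nvw] := eqVneq v w; first by rewrite subrr linear0 addr0.
have [|k k0 hk] := ucJ (eps := `|v - w|); first by rewrite normr_gt0 subr_eq0.
by have := hk v w (lexx _); lra.
Qed.

(** On the unit sphere around the minimizer the outward slope of [J] is at
    least the gap [k] of uniform convexity at distance [1]; by convexity [J]
    grows at least linearly with slope [k] beyond it. *)
Lemma sublevel_bounded (u : W) (b : R) : (forall v, J u <= J v) ->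
  exists M : R, forall v, J v <= b -> `|v| <= M.
Proof.
move=> umin.
have [k k0 hk] := ucJ ltr01.
exists (`|u| + 1 + `|b - J u| / k) => v vb.
have [le1|gt1] := leP `|v - u| 1.
  have := ler_normD u (v - u); rewrite subrKC => n.
  have : 0 <= `|b - J u| / k by rewrite divr_ge0 // ltW.
  lra.
pose r := `|v - u|.
have r0 : r != 0 by rewrite gt_eqF // /r; lra.
pose e := r^-1 *: (v - u).
have ne : `|e| = 1.
  by rewrite /e normrZ ger0_norm ?invr_ge0 ?/r // mulVf.
have ve : v - (u + e) = (r - 1) *: e.
  by rewrite /e scalerBl scale1r scalerA divff // scale1r opprD addrA.
have h1 := uniformly_convex_convex v (u + e).
rewrite ve diffZ in h1.
have := hk u (u + e).
rewrite opprD addrA subrr add0r normrN ne linearN /= => /(_ (lexx _)) h2.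
have h3 := umin (u + e).
have h4 : (r - 1) * k <= b - J u.
  by have : 1 < r by []; nra.
have h5 : r <= 1 + `|b - J u| / k.
  rewrite -lerBlDl ler_pdivlMr //; apply: le_trans h4 _; exact: ler_norm.
have := ler_normD u (v - u); rewrite subrKC -/r; lra.
Qed.

(** The gap in uniform convexity between [x] and a point [y i] close to [x']
    gives [J (y i) + 'd J (y i) (x - y i) + k <= J x].  In the linear term [x]
    may be replaced by [x'], and it is then small: convexity at the reflection
    [2 y i - x'] bounds it below by [J (y i) - J (2 y i - x')], which tends to
    [0].  No continuity of the differential is involved. *)
Lemma separating_lt (I : Type) (y : I -> W) (x x' : W) :
  closure (range y) x' -> x != x' ->
  (forall i, 'd J (y i) x = 'd J (y i) x') -> J x' < J x.
Proof.
move=> cx' nx eqx.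
have e0 : 0 < `|x - x'| / 2 by rewrite divr_gt0 // normr_gt0 subr_eq0.
have [k k0 hk] := ucJ e0.
have gc : 2 * J v - J (v + v - x') @[v --> x'] --> (2 * J x' - J x' : R).
  have Jc : J v @[v --> x'] --> J x' by exact: differentiable_continuous.
  apply: cvgB; first by apply: cvgM; [exact: cvg_cst|exact: Jc].
  have c2 : v + v - x' @[v --> x'] --> x' + x' - x'.
    by apply: cvgB; [apply: cvgD; exact: cvg_id|exact: cvg_cst].
  by rewrite addrK in c2; exact: (cvg_comp _ _ c2 Jc).
have near1 : \forall v \near x', 2 * J x' - J x' - k < 2 * J v - J (v + v - x').
  by apply: (cvgr_gt _ gc); lra.
have near2 : \forall v \near x', `|x' - v| < `|x - x'| / 2.
  by apply/nbhs_normP; exists (`|x - x'| / 2).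
have [_ [[i _ <-] [g1 g2]]] := cx' _ (filterI near1 near2).
have xy : `|x - x'| / 2 <= `|x - y i|.
  have := ler_normD (x - y i) (y i - x').
  by rewrite subrKA [`|y i - x'|]distrC; lra.
have := hk _ _ xy.
have := uniformly_convex_convex (y i + y i - x') (y i).
have -> : y i + y i - x' - y i = y i - x' by rewrite addrAC addrK.
rewrite !(dualB _ _ (dual_diff dJ _)) eqx; lra.
Qed.

Lemma separating_eq (I : Type) (y : I -> W) (x x' : W) :
  closure (range y) x -> closure (range y) x' ->
  (forall i, 'd J (y i) x = 'd J (y i) x') -> x = x'.
Proof.
move=> cx cx' eqx; apply/eqP; apply: contraT => nx.
have lt1 := separating_lt cx' nx eqx.
rewrite eq_sym in nx.
have := separating_lt cx nx (fun i => esym (eqx i)).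
by rewrite ltNge (ltW lt1).
Qed.

(** Optimality along a cone forces the differential to vanish on the cone, hence
    on the closure of its span; for a convex functional a zero of the
    differential is a minimizer. *)
Lemma argmin_cone (S : set W) (w : W) :
  (forall v (a : R), S v -> S (a *: v)) -> dense (linear_span S) ->
  (forall z, S z -> J w <= J (w + z)) -> forall v, J w <= J v.
Proof.
move=> cone dS wS v.
have dS0 z : S z -> 'd J w z = 0.
  have ge0 h : S h -> 0 <= 'd J w h.
    by move=> Sh; apply: diff_ge0 => // k; apply: wS; exact: cone.
  move=> Sz; apply/eqP; rewrite eq_le ge0 // andbT.
  have := ge0 _ (cone _ (-1) Sz).
  by rewrite diffZ mulN1r oppr_ge0.
have span0 : linear_span S `<=` [set h | 'd J w h = 0].
  apply: smallest_sub; last exact: dS0.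
  split; first by rewrite inE /= linear0.
  move=> a h1 h2; rewrite !inE /= linearD diffZ => -> ->.
  by rewrite mulr0 addr0.
have d0 h : 'd J w h = 0.
  apply/eqP; apply: contraT => nh.
  have op : open [set z : W | 'd J w z != 0].
    apply: (@open_comp _ _ ('d J w) [set r | r != 0]).
      by move=> z _; have [_] := dual_diff dJ w; exact.
    exact: open_neq.
  have [z [/= nz /span0 /= z0]] := dS _ (ex_intro _ h nh) op.
  by rewrite z0 eqxx in nz.
by have := uniformly_convex_convex v w; rewrite d0 addr0.
Qed.

End UniformlyConvex.

(** * Weak compactness of bounded sequences *)

Section WeakCompactness.
Context {R : realType} {W : completeNormedModType R} (J : W -> R^o) (u0 : W)
  (dJ : forall v : W, differentiable J v) (ucJ : uniformly_convex J)
  (u0min : forall v, J u0 <= J v).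

(** By uniform convexity at the midpoint of two near-minimizers, minimizing
    sequences are Cauchy; so the minimum is attained by completeness alone. *)
Lemma exists_argmin (Y : set W) :
  closed Y -> midpoint_closed Y -> Y !=set0 -> exists y, is_argmin Y J y.
Proof.
move=> clY mY [y00 Yy00].
have hinf : has_inf (J @` Y).
  split; first by exists (J y00), y00.
  by exists (J u0) => _ [v _ <-].
pose I := inf (J @` Y).
have Ile v : Y v -> I <= J v by move=> Yv; apply: (ge_inf hinf.2); exists v.
have /choice[y hy] (n : nat) : exists v, Y v /\ J v < I + n.+1%:R^-1.
  have n0 : 0 < (n.+1%:R^-1 : R) by rewrite invr_gt0.
  by have [_ [v Yv <-] vI] := inf_adherent n0 hinf; exists v.
have cau : cauchy (y @ \oo).
  apply/cauchy_ballP => e e0.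
  have e20 : 0 < e / 2 by rewrite divr_gt0.
  have [k k0 hk] := ucJ e20.
  have k20 : 0 < k / 2 by rewrite divr_gt0.
  have Nk : \forall n \near \oo, J (y n) < I + k / 2.
    near=> n; apply: lt_trans (hy n).2 _; rewrite ltrD2l.
    by near: n; exact: (near_infty_natSinv_lt (PosNum k20)).
  exists ([set v | Y v /\ J v < I + k / 2], [set v | Y v /\ J v < I + k / 2]).
    by split; apply: (@filterS _ \oo _ _ _ _ Nk) => n nI; split => //=;
      have [] := hy n.
  move=> [v w] /= [[Yv vI] [Yw wI]]; rewrite -ball_normE /=.
  rewrite ltNge; apply/negP => vw.
  pose m := (2^-1 : R) *: (v + w).
  pose h := (2^-1 : R) *: (v - w).
  have vm : v - m = h.
    rewrite -{1}[v]scale_half_double /m /h -scalerBr; congr (_ *: _).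
    by rewrite opprD addrACA subrr add0r.
  have wm : w - m = - h.
    rewrite -{1}[w]scale_half_double /m /h -scalerBr -scalerN.
    by congr (_ *: _); rewrite opprD addrACA subrr addr0 opprB.
  have hv := hk v m; rewrite vm in hv.
  have hw := hk w m; rewrite wm linearN normrN in hw.
  have he : e / 2 <= `|h|.
    by rewrite /h normrZ ger0_norm ?invr_ge0// mulrC ler_pM2l// invr_gt0.
  have := hv he; have := hw he; have := Ile _ (mY _ _ Yv Yw); rewrite -/m /=.
  lra.
have /cauchy_cvgP/cvg_ex[y0 yy0] := cau.
have Yy0 : Y y0.
  by apply: (closed_cvg Y clY _ _ yy0); apply: nearW => n; exact: (hy n).1.
exists y0; split => // v /Ile; apply: le_trans.
have Jy : J (y n) @[n --> \oo] --> J y0.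
  by apply: (cvg_comp _ _ yy0); exact: differentiable_continuous.
apply/ler_addgt0Pr => e e0.
apply: (cvg_le _ Jy); near=> n; apply: ltW; apply: lt_trans (hy n).2 _.
rewrite ltrD2l; near: n; exact: (near_infty_natSinv_lt (PosNum e0)).
Unshelve. all: by end_near. Qed.

(** The set is translated by [u0 - x], so that the claim becomes that the
    translate [Y'] contains [u0].  At the minimizer [y] of [J] over [Y'] the
    differential is nonnegative on [Y' - y], hence on its weak limit [u0 - y];
    were [y] different from [u0], uniform convexity would make [J u0] larger
    than [J y]. *)
Lemma weak_limit_mem (T : Type) (F : set_system T) (u : T -> W) (x : W)
    (Y : set W) : ProperFilter F -> closed Y -> midpoint_closed Y ->
  (forall t, Y (u t)) ->
  (forall f, dual_space W f -> f (u t) @[t --> F] --> f x) -> Y x.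
Proof.
move=> FF clY mY Yu ux.
pose Y' := [set v | Y (v + (x - u0))].
have clY' : closed Y'.
  apply: (@closed_comp _ _ (fun v : W => v + (x - u0))) => // v _.
  by apply: cvgD; [exact: cvg_id|exact: cvg_cst].
have mY' : midpoint_closed Y'.
  move=> v w Y'v Y'w; have := mY _ _ Y'v Y'w; rewrite /Y' /=; congr (Y _).
  by rewrite addrACA [LHS]scalerDr scale_half_double.
have Y'u t : Y' (u t - (x - u0)) by rewrite /Y' /= subrK.
have [t0 _] := filter_ex (@filterT _ F _).
have [|y ymin] := exists_argmin clY' mY'.
  by exists (u t0 - (x - u0)).
have : 0 <= 'd J y (u0 - y).
  have -> : u0 - y = x - (x - u0 + y) by rewrite opprD addrA subKr.
  rewrite (dualB _ _ (dual_diff dJ y)).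
  have c : 'd J y (u t) - 'd J y (x - u0 + y) @[t --> F] -->
      ('d J y x - 'd J y (x - u0 + y) : R).
    by apply: cvgB; [apply: ux; exact: dual_diff|exact: cvg_cst].
  apply: (cvg_ge _ c); apply: nearW => t.
  rewrite -(dualB _ _ (dual_diff dJ y)) opprD addrA.
  exact: (diff_argmin_ge0 dJ mY' ymin).
have [Y'y _] := ymin.
have [u0y _|nuy] := eqVneq u0 y.
  by move: Y'y; rewrite /Y' /= -u0y subrKC.
have [|k k0 hk] := ucJ (eps := `|u0 - y|); first by rewrite normr_gt0 subr_eq0.
have := hk u0 y (lexx _); have := u0min y; lra.
Qed.

(** The subsequence is extracted so that it converges to [x] when tested
    against the differentials of [J] at the iterated midpoints of [u].  This
    is enough because all ultrafilter limits lie in the closed hull of [u],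
    whose points these differentials separate. *)
Lemma weakly_convergent_subsequence (u : nat -> W) (M : R) :
  reflexive_space W -> (forall n, `|u n| <= M) ->
  exists (phi : nat -> nat) (x : W),
    (forall k, (k <= phi k)%N) /\ weak_cvg (u \o phi) x.
Proof.
move=> refl uM.
(* [x] is a weak limit of [u] along some ultrafilter of tails. *)
have [F [FU sF]] := ultraFilterLemma (@eventually_filter : ProperFilter \oo).
have [x ux] := ultrafilter_weak_limit refl FU uM.
pose y := midpoint_tree u.
have mY := midpoint_closed_closure (@midpoint_closed_tree _ _ u).
have Yu n : closure (range y) (u n).
  by apply: subset_closure; exists (GenTree.Leaf n).
have Yx : closure (range y) x.
  by apply: (weak_limit_mem _ _ mY _ ux) => //; exact: closed_closure.
(* A finite number of conditions holds on a set of the ultrafilter, so step [k]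
   can treat all trees of code at most [k] at once. *)
have /choice[phi hphi] (k : nat) : exists n, (k <= n)%N /\
    forall t : GenTree.tree nat, (pickle t <= k)%N ->
      `|'d J (y t) x - 'd J (y t) (u n)| < k.+1%:R^-1.
  have near1 : F [set n | (k <= n)%N] by apply: sF; exact: nbhs_infty_ge.
  have near2 : F [set n | forall i : 'I_k.+1, forall t : GenTree.tree nat,
      unpickle i = Some t -> `|'d J (y t) x - 'd J (y t) (u n)| < k.+1%:R^-1].
    apply: filter_forall => i; case: unpickle => [t|]; last by apply: nearW.
    have /cvgrPdist_lt := ux _ (dual_diff dJ (y t)).
    have k0 : 0 < (k.+1%:R^-1 : R) by rewrite invr_gt0.
    by move=> /(_ _ k0); apply: filterS => n hn _ [<-].
  have [n [kn hn]] := filter_ex (filterI near1 near2).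
  exists n; split => // t tk.
  by apply: (hn (Ordinal (tk : (pickle t < k.+1)%N))) => /=; exact: pickleK.
have dphi t : 'd J (y t) (u (phi k)) @[k --> \oo] --> ('d J (y t) x : R).
  apply/cvgrPdist_lt => e e0; near=> k.
  have [_ /(_ t) hk] := hphi k.
  apply: (lt_trans (hk _)); first by near: k; exact: nbhs_infty_ge.
  by near: k; exact: (near_infty_natSinv_lt (PosNum e0)).
exists phi, x; split; first by move=> k; have [] := hphi k.
move=> f fd; apply/cvgrPdist_lt => e e0; apply: contrapT => nA.
set A := [set k | `|f x - f (u (phi k))| < e].
(* If [f] failed to converge, an ultrafilter [G] of bad indices would give
   another weak limit [x'], to be identified with [x]. *)
have G0P : ProperFilter (within (~` A) \oo).
  split; last exact: within_filter.
  move=> h; apply: nA; apply: (@filterS _ \oo _ _ _ _ h) => k hk.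
  by apply: contrapT => /hk.
have [G [GU sG]] := ultraFilterLemma G0P.
have GnA : G (~` A) by apply: sG; rewrite /within /=; exact: nearW.
have sGoo : \oo `<=` G.
  by move=> B hB; apply: sG; apply: (@filterS _ \oo _ _ _ _ hB) => k Bk _.
have [x' ux'] := ultrafilter_weak_limit refl GU (fun k => uM (phi k)).
have Yx' : closure (range y) x'.
  by apply: (weak_limit_mem _ _ mY _ ux') => //; exact: closed_closure.
have xx' : x = x'.
  apply: (separating_eq dJ ucJ Yx Yx') => t.
  have c : 'd J (y t) (u (phi k)) @[k --> G] --> ('d J (y t) x : R).
    by move=> B /dphi /sGoo.
  exact: (cvg_unique (@Rhausdorff R) c (ux' _ (dual_diff dJ (y t)))).
have /cvgrPdist_lt/(_ _ e0) := ux' _ fd; rewrite -xx' => GA.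
by have [k []] := filter_ex (filterI GA GnA).
Unshelve. all: by end_near. Qed.

End WeakCompactness.

(** * Progressive proper generalized decompositions *)

(** In each strategy the update is at least as good as the greedy correction:
    the subspace over which one minimizes contains it. *)
Lemma pgd_step_le (R : realType) (W : normedModType R) (S1 : set W)
    (J : W -> R^o) a uprev zhat z unext :
  pgd_step S1 J a uprev zhat z unext ->
  forall z', S1 z' -> J unext <= J (uprev + z').
Proof.
move=> [[Szhat zmin] step] z' /zmin; apply: le_trans.
case: a step => [[-> ->] //|[<- [U [_ Uz [_ umin]]]]|[[U [_ Uz [_ hmin]]] ->]].
- exact: umin.
- exact: hmin.
Qed.

Unset Implicit Arguments.

Theorem theorem4 (R : realType) (d : nat) (hd : (0 < d)%N)
    (V_ : 'I_d -> completeNormedModType R)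
    (V : normedModType R) (tensor : (forall j, V_ j) -> V)
    (htensor : algebraic_tensor_product tensor)
    (W : completeNormedModType R) (iota : V -> W)
    (hW : completion iota) (hrefl : reflexive_space W)
    (S1 : set W) (hS1 : weakly_closed S1)
    (hB1 : S1 `<=` range iota /\ S1 0)
    (hB2 : forall (v : W) (lambda : R), S1 v -> S1 (lambda *: v))
    (hB3 : dense (linear_span S1))
    (J : W -> R^o)
    (hA1 : forall v : W, differentiable J v)
    (hA2 : elliptic J)
    (hJ : weakly_seq_continuous J)
    (u : W) (hu : is_argmin setT J u)
    (u_ : nat -> W) (hu_ : progressive_pgd S1 J u_) :
  `|u - u_ m| @[m --> \oo] --> (0 : R).
Proof.
have umin v : J u <= J v by have [_] := hu; exact.
have uc := elliptic_uniformly_convex hA1 hA2.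
have [_ [alpha_ [zhat_ [z_ step]]]] := hu_.
have stepS m := pgd_step_le (step m).
have decr : {homo (fun m => J (u_ m) : R) : n m / (n <= m)%N >-> m <= n}.
  apply/nonincreasing_seqP => m.
  by rewrite -[in leRHS](addr0 (u_ m)); exact: stepS hB1.2.
have [M subM] := sublevel_bounded uc (J (u_ 0%N)) umin.
have [phi [w [phik uw]]] := weakly_convergent_subsequence hA1 uc umin hrefl
  (fun m => subM _ (decr _ _ (leq0n m))).
have /cvg_ex[/= L JL] : cvg (J (u_ m) @[m --> \oo] : set_system R).
  by apply: nonincreasing_is_cvgn => //; exists (J u) => _ [m _ <-].
have phioo : phi k @[k --> \oo] --> \oo.
  apply/cvgnyPge => A; near=> k; apply: leq_trans (phik k).
  by near: k; exact: nbhs_infty_ge.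
have LJw : L = J w.
  apply: (cvg_unique (@Rhausdorff R) _ (hJ _ _ uw)).
  exact: (cvg_comp _ _ phioo JL).
(* The values right after the subsequence also tend to [L]. *)
have JLS : J (u_ (phi k).+1) @[k --> \oo] --> (L : R).
  apply: (@cvg_comp _ _ _ (fun k => (phi k).+1) (fun m => J (u_ m)) _ \oo);
    last exact: JL.
  apply/cvgnyPge => A; near=> k; apply: leq_trans (leqW (phik k)).
  by near: k; exact: nbhs_infty_ge.
have wmin : forall v, J w <= J v.
  apply: (argmin_cone hA1 uc hB2 hB3) => z Sz; rewrite -LJw.
  have Jz : J (u_ (phi k) + z) @[k --> \oo] --> (J (w + z) : R).
    exact: (hJ _ _ (weak_cvg_addr (z := z) uw)).
  apply: (ler_cvg_to JLS Jz).
  by apply: nearW => k; exact: stepS.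
have Lu : L = J u by apply/eqP; rewrite eq_le LJw wmin umin.
apply/cvgrPdist_lt => e e0.
have [k k0 hk] := uc e e0.
have nearL : \forall m \near \oo, (J (u_ m) : R) < J u + k.
  by apply: (cvgr_lt _ JL); rewrite Lu; lra.
move: nearL; apply: filterS => m Jm.
rewrite sub0r normrN normr_id ltNge; apply/negP => em.
have := hk (u_ m) u; rewrite distrC => /(_ em).
suff : 0 <= 'd J u (u_ m - u) by lra.
by apply: diff_ge0 => // i; exact: umin.
Unshelve. all: by end_near. Qed.
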